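(* Let $2\le r\le n$ be integers and let $\mathrm{Cy}(r)=\{\alpha\in\mathcal S_n \mid \alpha(1)\neq 1 \text{ and } \alpha \text{ is an } r\text{-cycle}\}$. Then all eigenvalues of the Cayley graph $\Gamma(\mathcal S_n,\mathrm{Cy}(r))$ are integers.
   Context: $\mathcal S_n$ denotes the symmetric group on $[n]=\{1,\dots,n\}$. For a finite group $G$ and an inverse closed subset $S\subseteq G$, the Cayley graph $\Gamma(G,S)$ has vertex set $G$, and two vertices $u,v\in G$ are adjacent if and only if $v=su$ for some $s\in S$. The eigenvalues of a graph are the eigenvalues of its adjacency matrix (the $0/1$ matrix indexed by the vertices, with $(u,v)$-entry $1$ exactly when $u$ and $v$ are adjacent). *)

(* Defs.v *)
From mathcomp Require Import all_boot all_order all_algebra all_fingroup.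

Set Implicit Arguments.
Unset Strict Implicit.
Unset Printing Implicit Defensive.

Import GroupScope GRing.Theory.

Definition inverse_closed (gT : finGroupType) (S : {set gT}) : Prop :=
  forall s, s \in S -> s^-1 \in S.

Definition cayley_graph (gT : finGroupType) (S : {set gT}) : rel gT :=
  fun u v => [exists s in S, v == s * u].

Definition adjacency_matrix (R : pzRingType) (T : finType) (e : rel T) :
    'M[R]_#|T| :=
  \matrix_(i, j) (e (enum_val i) (enum_val j))%:R%R.

Definition is_cycle_of_length (T : finType) (r : nat) (s : {perm T}) : bool :=
  [exists x, (#|porbit s x| == r) && perm_on (porbit s x) s].

(* For {perm T}, the product s * t is s followed by t. With the opposite
   convention one gets an isomorphic Cayley graph, through u |-> u^-1, since
   the connection set is inverse closed (Cy_inverse_closed).                 *)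

(* The set [n] = {1, ..., n} is rendered as 'I_n = {0, ..., n.-1}, so that the
   point 1 is the ordinal of value 0; it exists as soon as 0 < n.            *)
Definition Cy (n r : nat) : {set 'S_n} :=
  [set s : 'S_n | [exists i : 'I_n, (val i == 0%N) && (s i != i)]
                  && is_cycle_of_length r s].

Lemma Cy_inverse_closed n r : inverse_closed (Cy n r).
Proof.
move=> s; rewrite !inE => /andP[/existsP[i /andP[i0 si]] /existsP[x /andP[cx px]]].
apply/andP; split.
  by apply/existsP; exists i; rewrite i0 (canF_eq (permKV s)) eq_sym.
by apply/existsP; exists x; rewrite porbitV cx perm_onV.
Qed.

(* Left and right eigenvalues of the adjacency matrix therefore agree. *)
Lemma cayley_graph_sym (gT : finGroupType) (S : {set gT}) :
  inverse_closed S -> symmetric (cayley_graph S).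
Proof.
move=> SV; suff E u v : cayley_graph S u v -> cayley_graph S v u.
  by move=> u v; apply/idP/idP; apply: E.
case/exists_inP=> s /SV sV /eqP->; apply/exists_inP; exists s^-1 => //.
by rewrite mulKg.
Qed.

(* Main.v *)
Require Import Defs.
From mathcomp Require Import all_boot all_order all_algebra all_fingroup.
From mathcomp Require Import algC algnum mxrepresentation spectral.

Set Implicit Arguments.
Unset Strict Implicit.
Unset Printing Implicit Defensive.

(** Why the eigenvalues are integers.

    The r-cycles moving the first point are the r-cycles of S_n with those of
    the point stabilizer S_(n-1) removed.  The adjacency matrix is therefore a
    difference of two sums of translation matrices: one over a set invariant
    under conjugation by S_n, the other over a set invariant under conjugation
    by S_(n-1).  The first sum is central in the group algebra, hence the two
    commute, and every eigenvalue a of the difference has the form b - c with b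
    and c eigenvalues of the two sums, read off on a common eigenvector
    (comm_eigenvalue_common).

    Each of b and c is rational (class_sum_eigenvalue_rat).  Let a group G act
    linearly, and let X be a subset of G that is invariant under conjugation by
    G and that contains, with each x, every generator of the cyclic group <x>.
    The eigenspace V of the sum of X for an eigenvalue b is a G-module, on which
    this sum is the scalar b; so b * dim V is the sum over X of the traces of x
    on V.  This sum of traces is an integer: the traces over a whole subgroup D
    add up to |D| times the dimension of the fixed points of D, because the
    average over D is idempotent, and by induction on the order of x the sum
    over the generators of <x> alone is also an integer, being the sum over <x>
    minus the contributions of its proper cyclic subgroups
    (mxtrace_generators_sum).  The set X is a disjoint union of such sets of
    generators.

    Finally, a is a rational root of the characteristic polynomial of an integer
    matrix, a monic integer polynomial, so a is an integer.

    Apart from the verification that cycles of a given length form a suitable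
    set X, nothing is special to symmetric groups: the argument proves
    cayley_setD_subgroup_integral for an arbitrary finite group and any of its
    subgroups. *)

Import GroupScope GRing.Theory Num.Theory.
Local Open Scope ring_scope.

(** * Integer sums over sets closed under change of generator *)

(** A field such as C carries no decidable test of being an integer, whence a
    predicate in Prop. *)
Definition integral_value (F : pzRingType) (x : F) : Prop :=
  exists z : int, x = z%:~R.

Lemma integral_valueB (F : pzRingType) (x y : F) :
  integral_value x -> integral_value y -> integral_value (x - y).
Proof. by case=> a -> [b ->]; exists (a - b); rewrite rmorphB. Qed.

Lemma integral_value_sum (F : pzRingType) (I : finType) (P : pred I) (f : I -> F) :
  (forall i, P i -> integral_value (f i)) -> integral_value (\sum_(i | P i) f i).
Proof.
move=> fP; elim/big_ind: _ => [|x y [a ->] [b ->]|//]; first by exists 0.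
by exists (a + b); rewrite rmorphD.
Qed.

Definition generator_closed (gT : finGroupType) (X : {set gT}) : Prop :=
  forall x y, x \in X -> <[y]> = <[x]> -> y \in X.

(** The classes of the relation <[x]> = <[y]> partition a generator-closed set,
    so integrality can be tested on one class at a time. *)
Lemma integral_sum_by_generators (F : pzRingType) (gT : finGroupType)
    (f : gT -> F) (X : {set gT}) :
    generator_closed X ->
    (forall x, x \in X -> integral_value (\sum_(y | <[y]> == <[x]>) f y)) ->
  integral_value (\sum_(x in X) f x).
Proof.
move=> Xgen fX; rewrite (partition_big (fun x => <[x]>) predT) //=.
apply: integral_value_sum => D _.
case: (pickP [pred x | (x \in X) && (<[x]> == D)]) => [x /andP[Xx /eqP <-]|noX].
  rewrite (eq_bigl (fun y => <[y]> == <[x]>)); first exact: fX.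
  by move=> y; apply: andb_idl => /eqP; apply: Xgen.
by rewrite big_pred0 //; exists 0.
Qed.

(** * Traces in a representation *)

(** In a full rank factorization P = C R, idempotence forces R C = 1, a matrix
    of size the rank of P with the same trace as P. *)
Lemma mxtrace_idempotent (F : fieldType) n (P : 'M[F]_n) :
  P *m P = P -> \tr P = (\rank P)%:R.
Proof.
move=> PP; have RC : row_base P *m col_base P = 1%:M.
  apply: (row_full_inj (col_base_full P)); apply: (row_free_inj (row_base_free P)).
  rewrite mulmx1 (mulmxA (col_base P)) -mulmxA mulmx_base.
  by rewrite PP.
by rewrite -{1}(mulmx_base P) mxtrace_mulC RC mxtrace1.
Qed.

(** The sum S over D satisfies S S = |D| S, so S / |D| is idempotent and the sum
    of traces is |D| times its rank. *)
Lemma mxtrace_subgroup_sum (F : numFieldType) (gT : finGroupType)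
    (G D : {group gT}) n (rG : mx_representation F G n) :
  D \subset G -> integral_value (\sum_(x in D) \tr (rG x)).
Proof.
move=> sDG; pose S := \sum_(x in D) rG x.
have nzD : #|D|%:R != 0 :> F by rewrite pnatr_eq0 -lt0n cardG_gt0.
have SS : S *m S = #|D|%:R *: S.
  rewrite {1}/S mulmx_suml (eq_bigr (fun=> S)) ?sumr_const ?scaler_nat // => x Dx.
  rewrite mulmx_sumr (reindex_inj (mulgI x^-1%g)) /=.
  apply: eq_big => [y|y Dy]; first by rewrite groupMl ?groupV.
  have Dy' : y \in D by rewrite groupMl ?groupV // in Dy.
  by rewrite -repr_mxM ?mulKVg ?(subsetP sDG) // groupM ?groupV.
have PP : (#|D|%:R^-1 *: S) *m (#|D|%:R^-1 *: S) = #|D|%:R^-1 *: S.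
  by rewrite -scalemxAl -scalemxAr SS !scalerA -mulrA mulVf ?mulr1.
exists (#|D| * \rank (#|D|%:R^-1 *: S))%N%:Z.
rewrite -raddf_sum /= -/S -pmulrn natrM -(mxtrace_idempotent PP) mxtraceZ.
by rewrite mulVKf.
Qed.

(** The sum over the whole of <[x]> is an integer; its part outside the
    generators runs over a generator-closed set of elements of smaller order, to
    which the induction hypothesis applies. *)
Lemma mxtrace_generators_sum (F : numFieldType) (gT : finGroupType)
    (G : {group gT}) n (rG : mx_representation F G n) x :
  x \in G -> integral_value (\sum_(y | <[y]> == <[x]>) \tr (rG y)).
Proof.
have [m] := ubnP #[x]; elim: m x => // m IHm x ltxm Gx.
have sxG : <[x]> \subset G by rewrite cycle_subG.
have := mxtrace_subgroup_sum rG sxG.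
rewrite (bigID (fun y => <[y]> == <[x]>)) /= => intx.
pose X := [set y in <[x]> | <[y]> != <[x]>].
have intX : integral_value (\sum_(y in X) \tr (rG y)).
  apply: integral_sum_by_generators => [y z|y]; rewrite !inE.
    move=> /andP[xy nxy] yz; rewrite yz nxy andbT.
    by rewrite -cycle_subG yz cycle_subG.
  case/andP=> xy nxy; apply: IHm; last exact: subsetP sxG _ xy.
  apply: leq_trans (ltxm : (#[x] <= m)%N).
  by rewrite /order proper_card // properEneq nxy cycle_subG.
have := integral_valueB intx intX.
rewrite [\sum_(y in X) _](eq_bigl (fun y => (y \in <[x]>) && (<[y]> != <[x]>))).
  rewrite addrK (eq_bigl (fun y => <[y]> == <[x]>)) // => y.
  by apply: andb_idl => /eqP <-; apply: cycle_id.
by move=> y; rewrite inE.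
Qed.

(** * Eigenvalues of class sums are rational *)

Lemma class_sum_comm (F : fieldType) (gT : finGroupType) (G : {group gT})
    n (rG : mx_representation F G n) (X : {set gT}) (g : gT) :
    X \subset G -> g \in G -> g \in 'N(X)%g ->
  rG g *m (\sum_(x in X) rG x) = (\sum_(x in X) rG x) *m rG g.
Proof.
move=> sXG Gg nXg; rewrite mulmx_sumr mulmx_suml (reindex_inj (conjg_inj g)) /=.
apply: eq_big => [x|x Xx]; first by rewrite memJ_norm.
have Xx' : x \in X by rewrite memJ_norm in Xx.
have Gx := subsetP sXG x Xx'.
by rewrite -!repr_mxM ?groupJ // -conjgC.
Qed.

(** Taking traces on the whole eigenspace, a G-module on which the class sum is
    the scalar b, expresses b times its dimension as an integer. *)
Lemma class_sum_eigenvalue_rat (F : numFieldType) (gT : finGroupType)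
    (G : {group gT}) n (rG : mx_representation F G n) (X : {set gT}) (b : F) :
    X \subset G -> G \subset 'N(X)%g -> generator_closed X ->
    eigenvalue (\sum_(x in X) rG x) b ->
  exists q : rat, b = ratr q.
Proof.
move=> sXG nXG Xgen; set B := \sum_(x in X) _ => bB; pose V := eigenspace B b.
have Vmod : mxmodule rG V.
  apply/mxmoduleP=> g Gg; apply/eigenspaceP.
  rewrite -mulmxA class_sum_comm ?(subsetP nXG) // -/B mulmxA.
  by rewrite (eigenspaceP (submx_refl V)) scalemxAl.
pose rV := submod_repr Vmod.
have sumV : \sum_(x in X) rV x = b%:M.
  apply: val_submod_inj; rewrite raddf_sum /=.
  rewrite (eq_bigr (fun x => val_submod 1%:M *m rG x)) => [|x Xx].
    rewrite -mulmx_sumr -/B (eigenspaceP (val_submodP 1%:M)).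
    by rewrite -mul_scalar_mx [RHS]val_submodE.
  by rewrite -{1}[submod_mx _ _]mul1mx val_submodJ // (subsetP sXG).
have [||z trV] := @integral_sum_by_generators F gT (fun x => \tr (rV x)) X.
- exact: Xgen.
- by move=> x Xx; apply: mxtrace_generators_sum; apply: subsetP Xx.
rewrite -raddf_sum /= sumV mxtrace_scalar -mulr_natr in trV.
have nzr : (\rank V)%:R != 0 :> F.
  by rewrite pnatr_eq0 mxrank_eq0.
exists (z%:~R / (\rank V)%:R).
by rewrite rmorphM /= fmorphV /= ratr_int ratr_nat -trV mulfK.
Qed.

(** * Eigenvalues of integer matrices and of commuting matrices *)

(** The rational root theorem for the characteristic polynomial, through the
    fact that a rational algebraic integer is an integer.  The eigenvalue is
    moved from F to rat and then to algC, where algebraic integers live. *)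
Lemma eigenvalue_int_mx_rat (F : numFieldType) n (A : 'M[int]_n) (q : rat) :
  eigenvalue (map_mx intr A : 'M[F]_n) (ratr q) -> exists z : int, q = z%:~R.
Proof.
have intE (R : numFieldType) : (intr : int -> R) =1 ratr \o intr.
  by move=> z; rewrite /= ratr_int.
rewrite eigenvalue_root_char -map_char_poly.
have -> (R : numFieldType) : map_poly (intr : int -> R) (char_poly A)
    = map_poly ratr (map_poly intr (char_poly A) : {poly rat}).
  by rewrite -map_poly_comp; apply: eq_map_poly; apply: intE.
rewrite fmorph_root -(fmorph_root (ratr : rat -> algC)) => rootq.
have /intrP[z qz] : (ratr q : algC) \is a Num.int.
  apply: Cint_rat_Aint; first exact: Crat_rat.
  apply: root_monic_Aint rootq _ _; first by rewrite !monic_map ?char_poly_monic.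
  apply/polyOverP=> i; rewrite !coef_map /= ratr_int; exact: intr_int.
by exists z; rewrite -(ratr_int algC) in qz; apply: fmorph_inj qz.
Qed.

(** B stabilizes the eigenspace of A, so over a closed field its restriction to
    this eigenspace has an eigenvector. *)
Lemma comm_eigenvalue_common (C : numClosedFieldType) n (A B : 'M[C]_n) a :
    A *m B = B *m A -> eigenvalue A a ->
  exists (v : 'rV_n) (b : C), [/\ v != 0, v *m A = a *: v & v *m B = b *: v].
Proof.
move=> AB Aa; pose W := row_base (eigenspace A a).
have WA : W *m A = a *: W by apply/eigenspaceP; rewrite eq_row_base.
have WB : (W *m B <= W)%MS.
  suff: (W *m B <= eigenspace A a)%MS by rewrite eq_row_base.
  apply/eigenspaceP.
  by rewrite -mulmxA -AB mulmxA WA scalemxAl.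
have [|b /eigenvalueP[u ub nzu]] := eigenvalue_closed (W *m B *m pinvmx W).
  by rewrite lt0n mxrank_eq0.
have freeW : row_free W := row_base_free _.
clearbody W; exists (u *m W), b; split.
- by rewrite -(mul0mx 1 W) (inj_eq (row_free_inj freeW)).
- by rewrite -mulmxA WA scalemxAr.
by rewrite -mulmxA -(mulmxKpV WB) (mulmxA u) ub scalemxAl.
Qed.

(** * Cayley graphs and translations *)

(** The inverse makes g |-> translation_mx g multiplicative for matrices acting
    on row vectors. *)
Definition translation_mx (R : pzRingType) (gT : finGroupType) (g : gT) :
    'M[R]_#|gT| :=
  \matrix_(i, j) (enum_val j == g^-1 * enum_val i)%g%:R.

Lemma translation_mx_repr (R : comUnitRingType) (gT : finGroupType) (G : {group gT}) :
  mx_repr G (@translation_mx R gT).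
Proof.
split=> [|g h _ _]; apply/matrixP=> i j; rewrite !mxE.
  by rewrite invg1 mul1g (inj_eq enum_val_inj) eq_sym.
rewrite (bigD1 (enum_rank (g^-1 * enum_val i)%g)) //= big1 => [|k nk].
  by rewrite addr0 !mxE enum_rankK eqxx mul1r invMg mulgA.
by rewrite mxE -[enum_val k == _](inj_eq enum_rank_inj) enum_valK (negPf nk) mul0r.
Qed.

Definition translation_repr (R : comUnitRingType) (gT : finGroupType) (G : {group gT}) :
  mx_representation R G #|gT| := MxRepresentation (translation_mx_repr R G).

Lemma adjacency_translation_sum (R : comUnitRingType) (gT : finGroupType) (S : {set gT}) :
    inverse_closed S ->
  adjacency_matrix R (cayley_graph S) = \sum_(s in S) translation_mx R s.
Proof.
move=> SV; apply/matrixP=> i j; rewrite summxE mxE.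
set u := enum_val i; set v := enum_val j.
have uv s : (v == s^-1 * u)%g = (s == u * v^-1)%g.
  by rewrite -(inj_eq (mulgI s)) mulKVg -(inj_eq (mulIg v^-1%g)) mulgK.
rewrite (eq_bigr (fun s => (s == u * v^-1)%g%:R)) => [|s _]; last by rewrite mxE uv.
have -> : cayley_graph S u v = (u * v^-1 \in S)%g.
  apply/exists_inP/idP=> [[s Ss /eqP->]|Suv].
    by rewrite invMg mulgA mulgV mul1g SV.
  exists (u * v^-1)^-1%g; first exact: SV.
  by rewrite invMg invgK mulgKV.
have [Suv|notSuv] := boolP (_ \in S).
  rewrite (bigD1 (u * v^-1)%g) //= eqxx big1 ?addr0 // => s /andP[_ /negPf ->] //.
by rewrite big1 // => s Ss; case: eqP Ss => // ->; rewrite (negPf notSuv).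
Qed.

Lemma generator_closedI (gT : finGroupType) (X : {set gT}) (H : {group gT}) :
  generator_closed X -> generator_closed (X :&: H).
Proof.
move=> Xgen x y /setIP[Xx Hx] yx; rewrite inE (Xgen x) //.
by rewrite -cycle_subG yx cycle_subG.
Qed.

Lemma generator_closedD (gT : finGroupType) (X : {set gT}) (H : {group gT}) :
  generator_closed X -> generator_closed (X :\: H).
Proof.
move=> Xgen x y /setDP[Xx nHx] yx; rewrite inE (Xgen x) // andbT.
by rewrite -cycle_subG yx cycle_subG.
Qed.

Lemma generator_closed_inverse (gT : finGroupType) (X : {set gT}) :
  generator_closed X -> inverse_closed X.
Proof. by move=> Xgen x Xx; apply: Xgen Xx _; rewrite cycleV. Qed.

(** Removing from a class sum of gT its part in H leaves a difference of two
    commuting class sums, one for gT and one for H, so its eigenvalues are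
    differences of rational numbers; the adjacency matrix being integral, they
    are integers. *)
Theorem cayley_setD_subgroup_integral (C : numClosedFieldType)
    (gT : finGroupType) (X : {set gT}) (H : {group gT}) (a : C) :
    generator_closed X -> [set: gT] \subset 'N(X)%g ->
    eigenvalue (adjacency_matrix C (cayley_graph (X :\: H))) a ->
  integral_value a.
Proof.
move=> Xgen nX; set A := adjacency_matrix _ _ => Aa.
have [q aq] : exists q : rat, a = ratr q.
  pose B (Y : {set gT}) := \sum_(s in Y) translation_mx C s.
  pose rG := translation_repr C [set: gT]; pose rH := translation_repr C H.
  have AE : A = B X - B (X :&: H).
    rewrite /A adjacency_translation_sum; last first.
      exact/generator_closed_inverse/generator_closedD.
    by rewrite /B [\sum_(s in X) _](big_setID H) /= [RHS]addrC addKr.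
  have commB : A *m B X = B X *m A.
    rewrite AE mulmxBl mulmxBr; congr (_ - _).
    rewrite [LHS]mulmx_suml [RHS]mulmx_sumr; apply: eq_bigr => s _.
    exact: (class_sum_comm rG) (subsetT X) (in_setT s) (subsetP nX s (in_setT s)).
  have [v [b [nzv vA vB]]] := comm_eigenvalue_common commB Aa.
  have [p bp] : exists p : rat, b = ratr p.
    apply: (@class_sum_eigenvalue_rat _ _ _ _ rG X) => //.
      exact: subsetT.
    by apply/eigenvalueP; exists v.
  have [p' cp] : exists p' : rat, b - a = ratr p'.
    apply: (@class_sum_eigenvalue_rat _ _ _ _ rH (X :&: H)).
    - exact: subsetIr.
    - by rewrite normsI ?normG // (subset_trans (subsetT H)).
    - exact: generator_closedI.
    apply/eigenvalueP; exists v => //.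
    have -> : \sum_(x in X :&: H) rH x = B X - A by rewrite AE opprB addrC subrK.
    by rewrite mulmxBr vA vB scalerBl.
  by exists (p - p'); rewrite rmorphB /= -bp -cp opprB addrC subrK.
rewrite {a}aq in Aa *.
pose M : 'M[int]_#|gT| := adjacency_matrix int (cayley_graph (X :\: H)).
have AM : A = map_mx intr M by apply/matrixP=> i j; rewrite !mxE rmorph_nat.
rewrite AM in Aa; have [z ->] := eigenvalue_int_mx_rat Aa.
by exists z; rewrite ratr_int.
Qed.

(** * Cycles of a given length *)

Lemma cycle_eq_fix (T : finType) (s t : {perm T}) x :
  <[s]>%g = <[t]>%g -> (s x == x) = (t x == x).
Proof.
move=> st; have fixE (u : {perm T}) : (u x == x) = (<[u]>%g \subset 'C[x | 'P]%g).
  by rewrite cycle_subG; apply/eqP/astab1P.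
by rewrite !fixE st.
Qed.

Definition r_cycles (T : finType) (r : nat) : {set {perm T}} :=
  [set s | is_cycle_of_length r s].

Lemma r_cycles_generator_closed (T : finType) r : generator_closed (r_cycles T r).
Proof.
move=> s t; rewrite !inE => /existsP[x /andP[cx /subsetP px]] ts.
apply/existsP; exists x; rewrite !porbitE ts -porbitE cx /=.
apply/subsetP=> y; rewrite inE (cycle_eq_fix y ts) => sy.
by apply: px; rewrite inE.
Qed.

Lemma porbit_conjg (T : finType) (s g : {perm T}) x :
  porbit (s ^ g)%g (g x) = g @: porbit s x.
Proof.
apply/setP=> y; apply/porbitP/imsetP => [[i ->]|[z /porbitP[i ->] ->]].
  exists ((s ^+ i)%g x); first exact: mem_porbit.
  by rewrite -conjXg permJ.
by exists i; rewrite -conjXg permJ.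
Qed.

Lemma r_cycles_norm (T : finType) r : [set: {perm T}] \subset 'N(r_cycles T r)%g.
Proof.
apply/subsetP=> g _; suff sub h : (r_cycles T r :^ h \subset r_cycles T r)%g.
  by rewrite inE.
apply/subsetP=> _ /imsetP[s + ->]; rewrite !inE => /existsP[x /andP[cx px]].
apply/existsP; exists (h x); rewrite porbit_conjg card_imset ?cx; last exact: perm_inj.
apply/subsetP=> y; rewrite inE -{1 2}(permKV h y) permJ (inj_eq perm_inj) => sy.
by rewrite -(permKV h y) imset_f // (subsetP px) // inE.
Qed.

Lemma Cy_setD_stabilizer n r (i : 'I_n) :
  val i = 0%N -> Cy n r = r_cycles 'I_n r :\: 'C[i | 'P]%g.
Proof.
move=> i0; apply/setP=> s.
rewrite in_set in_setD [s \in r_cycles _ _]in_set; congr (_ && _).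
have -> : (s \in 'C[i | 'P]%g) = (s i == i) by apply/astab1P/eqP.
apply/existsP/idP=> [[j /andP[/eqP j0 sj]]|si]; last by exists i; rewrite i0.
by have <- : j = i by apply: val_inj; rewrite j0.
Qed.

Theorem theorem1p4 (C : numClosedFieldType) (n r : nat)
    (hr : (2 <= r)%N) (hrn : (r <= n)%N) (a : C)
    (ha : eigenvalue (adjacency_matrix C (cayley_graph (Cy n r))) a) :
  exists z : int, a = (z%:~R)%R.
Proof.
have n_gt0 : (0 < n)%N by apply: leq_trans hrn; apply: ltnW.
rewrite (@Cy_setD_stabilizer n r (Ordinal n_gt0)) // in ha.
apply: cayley_setD_subgroup_integral ha; first exact: r_cycles_generator_closed.
exact: r_cycles_norm.
Qed.
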